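(* Let $G=\mathbb{Z}/2\mathbb{Z}\star\mathbb{Z}/3\mathbb{Z}$, with $a$ and $b$ generators of $\mathbb{Z}/2\mathbb{Z}$ and $\mathbb{Z}/3\mathbb{Z}$ respectively, and let $\Sigma=\{a,b,b^2\}$. Let $p,q\ge 0$ with $0<p+q<1$, set $r=1-p-q$, and let $\mu$ be the probability measure with $\mu(a)=r$, $\mu(b)=p$, $\mu(b^2)=q$. Then the drift (with respect to $\Sigma$) of the random walk $(G,\mu)$ is $$\gamma=\frac{2r\Bigl(pq-p-q+\sqrt{(p^2+q^2)\bigl(3+(r+p)^2+(r+q)^2\bigr)+2pq(2r+1)}\Bigr)}{(r+p)^2+(r+q)^2-pq+2}.$$
   Context: Random walk $(G,\mu)$: $X_0=1$, $X_{n+1}=X_nx_n$ with $(x_n)$ i.i.d. of law $\mu$. The length $|g|$ of $g\in G$ is its word length with respect to $\Sigma$ (equivalently, the number of letters in its free-product normal form), and the drift is $\gamma=\lim_n|X_n|/n$ (a.s.). *)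

(* Defs.v *)
From HB Require Import structures.
From mathcomp Require Import all_boot all_order all_algebra all_fingroup.
From mathcomp Require Import finmap all_solvable.
From mathcomp Require Import all_classical all_reals all_analysis.

Set Implicit Arguments.
Unset Strict Implicit.
Unset Printing Implicit Defensive.

Import numFieldNormedType.Exports.

Local Open Scope classical_set_scope.

(** The free product of two groups, as the set of reduced words: a letter is a
    non-trivial element of one of the two factors, and two consecutive letters
    never belong to the same factor.  [freeprod_universal] below is the
    universal property. *)
Section FreeProduct.
Local Open Scope group_scope.
Variables A B : groupType.

Definition nontrivial_letter (l : A + B) : bool :=
  match l with inl x => x != 1 | inr y => y != 1 end.

Definition alternate (l m : A + B) : bool :=
  match l, m with inl _, inr _ | inr _, inl _ => true | _, _ => false end.

Definition reduced (w : seq (A + B)) : bool :=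
  all nontrivial_letter w && sorted alternate w.

Record freeprod : Type := FreeProd
  { normal_form : seq (A + B); normal_formP : reduced normal_form }.

HB.instance Definition _ := [isSub for normal_form].
HB.instance Definition _ := [Choice of freeprod by <:].

Definition push (l : A + B) (w : seq (A + B)) : seq (A + B) :=
  if nontrivial_letter l then l :: w else w.

(* Product of a letter and a reduced word; if the word starts in the factor of
   the letter, the two letters are merged, and disappear if they cancel. *)
Definition lmul (l : A + B) (w : seq (A + B)) : seq (A + B) :=
  match l, w with
  | inl x, inl x' :: w' => push (inl (x * x')) w'
  | inr y, inr y' :: w' => push (inr (y * y')) w'
  | _, _ => push l w
  end.

Definition wmul (u v : seq (A + B)) : seq (A + B) := foldr lmul v u.

Definition linv (l : A + B) : A + B :=
  match l with inl x => inl x^-1 | inr y => inr y^-1 end.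

Definition winv (u : seq (A + B)) : seq (A + B) := rev (map linv u).

Lemma reduced_behead l w : reduced (l :: w) -> reduced w.
Proof.
by case/andP=> /andP[_ ww] /path_sorted sw; apply/andP; split.
Qed.

Lemma reduced_cons l w : reduced (l :: w) =
  [&& nontrivial_letter l, reduced w & if w is m :: _ then alternate l m else true].
Proof.
case: w => [|m w]; rewrite /reduced /= ?andbT //.
case: (nontrivial_letter l) => //=; case: (nontrivial_letter m) => //=.
by case: (all _ w) => //=; rewrite andbC.
Qed.

Lemma reduced_push l w : reduced w ->
  (if w is m :: _ then alternate l m else true) -> reduced (push l w).
Proof.
by move=> rw lw; rewrite /push; case: ifP => // nl; rewrite reduced_cons nl rw.
Qed.

Lemma reduced_lmul l w : reduced w -> reduced (lmul l w).
Proof.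
case: l w => [x|y] [|[x'|y'] w] rw /=; apply: reduced_push => //;
  try exact: reduced_behead rw.
all: by move: rw; rewrite reduced_cons; case: w => [|[?|?] w] // /and3P[].
Qed.

Lemma reduced_wmul u v : reduced v -> reduced (wmul u v).
Proof. by move=> rv; elim: u => //= l u IH; exact: reduced_lmul. Qed.

Lemma lmul1l w : reduced w -> lmul (inl 1) w = w.
Proof.
case: w => [|[x|y] w] /=; rewrite /push /= ?eqxx // mul1g.
by rewrite reduced_cons => /and3P[/= -> _ _].
Qed.

Lemma lmul1r w : reduced w -> lmul (inr 1) w = w.
Proof.
case: w => [|[x|y] w] /=; rewrite /push /= ?eqxx // mul1g.
by rewrite reduced_cons => /and3P[/= -> _ _].
Qed.

Lemma lmulMl x y w : reduced w ->
  lmul (inl x) (lmul (inl y) w) = lmul (inl (x * y)) w.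
Proof.
case: w => [|[z|z] w] rw.
- by rewrite /= /push /=; case: (eqVneq y 1) => [->|_] //=; rewrite mulg1.
- rewrite /= /push /=; case: (eqVneq (y * z) 1) => [yz|_] /=; last first.
    by rewrite /push /= mulgA.
  rewrite -mulgA yz mulg1.
  by case: w rw => [|[t|t] w] //; rewrite reduced_cons => /and3P[].
- by rewrite /= /push /=; case: (eqVneq y 1) => [->|_] //=; rewrite mulg1.
Qed.

Lemma lmulMr x y w : reduced w ->
  lmul (inr x) (lmul (inr y) w) = lmul (inr (x * y)) w.
Proof.
case: w => [|[z|z] w] rw.
- by rewrite /= /push /=; case: (eqVneq y 1) => [->|_] //=; rewrite mulg1.
- by rewrite /= /push /=; case: (eqVneq y 1) => [->|_] //=; rewrite mulg1.
- rewrite /= /push /=; case: (eqVneq (y * z) 1) => [yz|_] /=; last first.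
    by rewrite /push /= mulgA.
  rewrite -mulgA yz mulg1.
  by case: w rw => [|[t|t] w] //; rewrite reduced_cons => /and3P[].
Qed.

Lemma wmul_push l t w : reduced w ->
  wmul (push l t) w = lmul l (wmul t w).
Proof.
move=> rw; rewrite /push; case: ifP => //.
case: l => x /negbFE/eqP ->; rewrite ?lmul1l ?lmul1r //; exact: reduced_wmul.
Qed.

Lemma wmul_lmul l t w : reduced t -> reduced w ->
  wmul (lmul l t) w = lmul l (wmul t w).
Proof.
move=> rt rw; have rwm t' := reduced_wmul t' rw.
case: l t rt => x [|[y|y] t] rt; rewrite [lmul _ _]/= wmul_push //.
- exact: esym (lmulMl _ _ (rwm _)).
- exact: esym (lmulMr _ _ (rwm _)).
Qed.

Lemma wmulA u v w : reduced u -> reduced v -> reduced w ->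
  wmul u (wmul v w) = wmul (wmul u v) w.
Proof.
move=> + rv rw; elim: u => //= l u IH /reduced_behead ru.
by rewrite wmul_lmul ?IH //; exact: reduced_wmul.
Qed.

Lemma wmulw0 u : reduced u -> wmul u [::] = u.
Proof.
elim: u => //= l u IH rlu; rewrite IH; last exact: reduced_behead rlu.
move: rlu; rewrite reduced_cons => /and3P[nl _].
by case: l nl => x nl; case: u {IH} => [|[y|y] u] //= _; rewrite /push nl.
Qed.

Lemma reduced_winv u : reduced u -> reduced (winv u).
Proof.
rewrite /reduced /winv all_rev all_map rev_sorted sorted_map => /andP[au su].
apply/andP; split.
  by apply: sub_all au => -[x|y] /=; rewrite eq_invg1.
by apply: sub_sorted su => -[?|?] [?|?].
Qed.

Lemma wmul_cat u v w : wmul (u ++ v) w = wmul u (wmul v w).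
Proof. exact: foldr_cat. Qed.

Lemma wmulVw u : reduced u -> wmul (winv u) u = [::].
Proof.
elim: u => // l u IH rlu; have ru := reduced_behead rlu.
rewrite /winv /= rev_cons -cats1 wmul_cat /= -[RHS](IH ru); congr foldr.
have /wmulw0 := rlu; rewrite /= wmulw0 // => <-.
by case: l {rlu} => x; rewrite [linv _]/= ?lmulMl ?lmulMr // mulVg ?lmul1l ?lmul1r.
Qed.

Lemma wmulwV u : reduced u -> wmul u (winv u) = [::].
Proof.
have winvK v : winv (winv v) = v.
  rewrite /winv map_rev revK -map_comp map_id_in // => -[x|x] _ /=;
  by rewrite invgK.
by move=> /reduced_winv/wmulVw; rewrite winvK.
Qed.

Definition fp1 : freeprod := @FreeProd [::] isT.
Definition fpmul (u v : freeprod) : freeprod :=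
  FreeProd (reduced_wmul (normal_form u) (normal_formP v)).
Definition fpinv (u : freeprod) : freeprod :=
  FreeProd (reduced_winv (normal_formP u)).

Lemma fpmulA : associative fpmul.
Proof. by move=> [u ru] [v rv] [w rw]; apply: val_inj; exact: wmulA. Qed.
Lemma fpmul1g : left_id fp1 fpmul.
Proof. by move=> [u ru]; exact: val_inj. Qed.
Lemma fpmulg1 : right_id fp1 fpmul.
Proof. by move=> [u ru]; apply: val_inj; exact: wmulw0. Qed.
Lemma fpmulVg : left_inverse fp1 fpinv fpmul.
Proof. by move=> [u ru]; apply: val_inj; exact: wmulVw. Qed.
Lemma fpmulgV : right_inverse fp1 fpinv fpmul.
Proof. by move=> [u ru]; apply: val_inj; exact: wmulwV. Qed.

HB.instance Definition _ :=
  isGroup.Build freeprod fpmulA fpmul1g fpmulg1 fpmulVg fpmulgV.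

HB.instance Definition _ := isPointed.Build freeprod 1.

HB.instance Definition _ := @isMeasurable.Build default_measure_display
  freeprod discrete_measurable discrete_measurable0
  discrete_measurableC discrete_measurableU.

Lemma reduced_letter l : reduced (push l [::]).
Proof. exact: reduced_push. Qed.

Definition fpl (x : A) : freeprod := FreeProd (reduced_letter (inl x)).
Definition fpr (y : B) : freeprod := FreeProd (reduced_letter (inr y)).

Lemma fplM : {morph fpl : x y / x * y}.
Proof.
move=> x y; apply: val_inj; rewrite [RHS]wmul_push; last exact: reduced_letter.
exact: esym (@lmulMl x y [::] isT).
Qed.

Lemma fprM : {morph fpr : x y / x * y}.
Proof.
move=> x y; apply: val_inj; rewrite [RHS]wmul_push; last exact: reduced_letter.
exact: esym (@lmulMr x y [::] isT).
Qed.

Theorem freeprod_universal (H : groupType) (f : A -> H) (g : B -> H) :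
  {morph f : x y / x * y} -> {morph g : x y / x * y} ->
  exists! h : freeprod -> H, {morph h : u v / u * v} /\
    (forall x, h (fpl x) = f x) /\ (forall y, h (fpr y) = g y).
Proof.
move=> fM gM.
have morph1 (C D : groupType) (k : C -> D) : {morph k : x y / x * y} -> k 1 = 1.
  by move=> kM; apply: (@mulgI _ (k 1)); rewrite -kM !mulg1.
pose hl (l : A + B) : H := match l with inl x => f x | inr y => g y end.
pose hw (w : seq (A + B)) : H := foldr (fun l z => hl l * z) 1 w.
have hpush l w : hw (push l w) = hl l * hw w.
  rewrite /push; case: ifP => //.
  by case: l => x /negbFE/eqP -> /=; rewrite morph1 ?mul1g.
have hlmul l w : hw (lmul l w) = hl l * hw w.
  case: l w => x [|[y|y] w]; rewrite [lmul _ _]/= hpush //=.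
  - by rewrite fM mulgA.
  - by rewrite gM mulgA.
exists (fun u => hw (normal_form u)); split.
  split; [|split].
  - move=> [u ru] [v rv] /=; elim: u {ru} => [|l u IH] /=; first by rewrite mul1g.
    by rewrite hlmul IH mulgA.
  - by move=> x; rewrite hpush /= mulg1.
  - by move=> x; rewrite hpush /= mulg1.
move=> h [hM [hf hg]]; apply/funext => -[w]; elim: w => [|l w IH] rw /=.
  by rewrite -(morph1 _ _ h hM); congr h; exact: val_inj.
have rw' := reduced_behead rw.
have /= -> := IH rw'.
have -> : hl l = h (FreeProd (reduced_letter l)).
  by case: l {rw} => x /=; rewrite -?hf -?hg; congr h; exact: val_inj.
rewrite -hM; congr h; apply: val_inj => /=.
by rewrite wmul_push //=; have /wmulw0 := rw; rewrite /= wmulw0.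
Qed.

End FreeProduct.

Section WordLength.
Local Open Scope group_scope.
Variable G : groupType.

(* [S] is meant to be closed under inverses, so that words in [S] exhaust the
   subgroup that it generates. *)
Definition is_product_of (S : set G) (g : G) (n : nat) : Prop :=
  exists s : seq G,
    [/\ size s = n, {in s, forall y, S y} & g = \prod_(y <- s) y].

(* By convention, the length is 0 outside of the subgroup generated by [S]. *)
Definition word_length (S : set G) (g : G) : nat :=
  match pselect (exists n, `[< is_product_of S g n >]) with
  | left ex => ex_minn ex
  | right _ => 0%N
  end.

Fixpoint random_walk (T : Type) (x : nat -> T -> G) (n : nat) (w : T) : G :=
  if n is m.+1 then random_walk x m w * x m w else 1.

End WordLength.

Section Probability.
Local Open Scope ereal_scope.
Context d d' (T : measurableType d) (T' : measurableType d') (R : realType).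
Variable P : probability T R.

Definition mutually_independent (x : nat -> {RV P >-> T'}) : Prop :=
  forall (J : {fset nat}) (E : nat -> set T'),
    (forall i, measurable (E i)) ->
    P (\bigcap_(i in [set` J]) (x i @^-1` E i)) =
    \prod_(i <- J) P (x i @^-1` E i).

Definition iid_of_law (x : nat -> {RV P >-> T'}) (mu : probability T' R) : Prop :=
  mutually_independent x /\
  forall n (E : set T'), measurable E -> distribution P (x n) E = mu E.

End Probability.

Definition is_drift d (T : measurableType d) (R : realType) (P : probability T R)
    (G : groupType) (S : set G) (X : nat -> T -> G) (gamma : R) : Prop :=
  {ae P, forall w : T,
    (((word_length S (X n w))%:R / n%:R : R)%R @[n --> \oo] --> gamma)}.

(* Main.v *)
Require Import Defs.
From HB Require Import structures.
From mathcomp Require Import all_boot all_order all_algebra all_fingroup.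
From mathcomp Require Import finmap all_solvable.
From mathcomp Require Import all_classical all_reals all_analysis.
From mathcomp Require Import zify ring lra.

(** The walk converges to a random infinite reduced word; its law is the
    [mu]-stationary measure, under which the letters [b], [b ^+ 2] of the word are
    independent with probabilities [rho], [1 - rho], and the first letter is [a]
    with probability [alpha].  Stationarity is a quadratic equation for [rho].
    Averaging the Busemann cocycle of [g] over this measure gives a function [psi]
    that stays at bounded distance from the length and whose mean increment along
    the walk is exactly a constant [gamma], by the cocycle identity.  Hence
    [psi (X_n) - n * gamma] is a martingale with bounded increments: an exponential
    moment bound and the Borel-Cantelli lemma give [psi (X_n) / n --> gamma]. *)

Set Implicit Arguments.
Unset Strict Implicit.
Unset Printing Implicit Defensive.

Import Order.TTheory GRing.Theory Num.Theory.
Import numFieldNormedType.Exports.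

Local Open Scope classical_set_scope.
Local Open Scope ring_scope.

(** * The stationary equation and the formula for the drift *)

(** Intermediate values: the two sides differ by [p * q - p - q] at [0] and by the opposite at
    [1]. *)
Lemma stationary_root_exists (R : realType) (p q : R) :
  0 <= p -> 0 <= q -> 0 < p + q -> p + q < 1 ->
  exists rho : R, [/\ 0 < rho, rho < 1 &
    (1 - p * rho - q * (1 - rho)) * ((1 - p - q) * (1 - rho) + q) + p * rho
      = 1 - rho].
Proof.
move=> p0 q0 pq0 pq1.
pose Q : {poly R} := (1 - p *: 'X - q *: (1 - 'X)) *
  ((1 - p - q) *: (1 - 'X) + q%:P) + p *: 'X - (1 - 'X).
have QE y : Q.[y] = (1 - p * y - q * (1 - y)) * ((1 - p - q) * (1 - y) + q)
    + p * y - (1 - y).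
  by rewrite /Q !hornerE.
have Q0 : Q.[0] < 0 by rewrite QE; nra.
have Q1 : 0 < Q.[1] by rewrite QE; nra.
have [|y /andP[y0 y1] /eqP] := @poly_ivt R Q 0 1 (@ler01 R).
  by rewrite !ltW.
rewrite QE => /eqP; rewrite subr_eq0 => /eqP Qy; exists y; split => //.
- rewrite lt_neqAle y0 andbT; apply/eqP => y_eq.
  by move: Qy Q0; rewrite QE -y_eq => ->; rewrite subrr ltxx.
- rewrite lt_neqAle y1 andbT; apply/eqP => y_eq.
  by move: Qy Q1; rewrite QE y_eq => ->; rewrite subrr ltxx.
Qed.

(** The radicand is the discriminant of the quadratic equation for [rho], so its root is the slope
    of the quadratic at [rho], once this is known to be nonnegative. After cross-multiplication the
    fractions differ by a multiple of the quadratic. *)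
Lemma stationary_drift (R : realType) (p q rho : R)
    (r := 1 - p - q) (t := 1 - p * rho - q * (1 - rho)) :
  0 <= p -> 0 <= q -> 0 < p + q -> p + q < 1 -> 0 < rho -> rho < 1 ->
  t * (r * (1 - rho) + q) + p * rho = 1 - rho ->
  (2 * (p + q) * t + p * (3 * rho - 2) + q * (1 - 3 * rho) + t - 1) / (1 + t) =
  2 * r * (p * q - p - q +
       Num.sqrt ((p ^+ 2 + q ^+ 2) * (3 + (r + p) ^+ 2 + (r + q) ^+ 2)
                 + 2 * p * q * (2 * r + 1)))
     / ((r + p) ^+ 2 + (r + q) ^+ 2 - p * q + 2).
Proof.
move=> p0 q0 pq0 pq1 rho0 rho1 Ht.
pose D := q - p.
pose A := - r * D; pose B := (r + q) * D - r * (1 - q) + p + 1.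
pose C := (r + q) * (1 - q) - 1.
have Qrho : A * rho ^+ 2 + B * rho + C = 0.
  by rewrite -(subrr (1 - rho)) -{1}Ht /A /B /C /D /t; ring.
have S_eq : (p ^+ 2 + q ^+ 2) * (3 + (r + p) ^+ 2 + (r + q) ^+ 2)
      + 2 * p * q * (2 * r + 1) = (2 * A * rho + B) ^+ 2.
  transitivity (B ^+ 2 - 4 * A * C + 4 * A * (A * rho ^+ 2 + B * rho + C)).
    by rewrite Qrho /A /B /C /D /r; ring.
  by ring.
(* The chords over [[0, rho]] and [[rho, 1]] have slopes [A * rho + B] and [A * (1 + rho) + B],
   positive by the signs at [0] and [1]; the slope at [rho] is their mean with weights [1 - rho] and
   [rho]. *)
have slope_ge0 : 0 <= 2 * A * rho + B.
  have C0 : C < 0 by rewrite /C /r; nra.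
  have ABC0 : 0 < A + B + C.
    by rewrite (_ : _ + C = p + q - p * q); [nra|rewrite /A /B /C /D /r; ring].
  have h0 : 0 < A * rho + B by rewrite -(pmulr_rgt0 _ rho0); nra.
  have h1 : 0 < A * (1 + rho) + B.
    by rewrite -(@pmulr_rgt0 _ (1 - rho)) ?subr_gt0//; nra.
  by nra.
have t0 : 0 < 1 + t by rewrite /t; nra.
have Den0 : 0 < (r + p) ^+ 2 + (r + q) ^+ 2 - p * q + 2 by rewrite /r; nra.
rewrite S_eq sqrtr_sqr ger0_norm //.
apply/eqP; rewrite eqr_div ?lt0r_neq0// -subr_eq0; apply/eqP.
transitivity (- 4 * r * D * (A * rho ^+ 2 + B * rho + C)); last first.
  by rewrite Qrho mulr0.
by rewrite /A /B /C /D /t /r; ring.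
Qed.

(** * Walks with a potential of constant mean increment *)

(** The Markov operator of the walk as a finite sum: its iterates at [1] stand for the expectations
    of [psi (X_n)], without integrals. *)
Definition transition (R : realType) (G : groupType) (S : seq G) (m : G -> R)
  (psi : G -> R) (g : G) : R := \sum_(l <- S) m l * psi (g * l)%g.

Section Transition.
Variables (R : realType) (G : groupType) (S : seq G) (m : G -> R).
Hypothesis m_ge0 : forall l, 0 <= m l.

Local Notation Q := (transition S m).

Lemma iter_transition_sum (psi : G -> G -> R) n g :
  iter n Q (fun h => \sum_(l <- S) m l * psi l h) g =
  \sum_(l <- S) m l * iter n Q (psi l) g.
Proof.
elim: n g => //= n IH g.
transitivity (\sum_(k <- S) \sum_(l <- S)
    m k * (m l * iter n Q (psi l) (g * k)%g)).
  by apply: eq_bigr => k _; rewrite IH big_distrr.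
rewrite exchange_big /=; apply: eq_bigr => l _.
by rewrite /transition big_distrr /=; apply: eq_bigr => k _; rewrite mulrCA.
Qed.

Lemma iter_transition_ge0 (psi : G -> R) n g :
  (forall h, 0 <= psi h) -> 0 <= iter n Q psi g.
Proof.
move=> psi0; elim: n g => //= n IH g.
by rewrite /transition sumr_ge0// => l _; rewrite mulr_ge0.
Qed.

Lemma iter_transition_le (psi : G -> R) (c : R) n g : 0 <= c ->
  (forall h, Q psi h <= c * psi h) -> iter n Q psi g <= c ^+ n * psi g.
Proof.
move=> c0 psic; elim: n g => [|n IH] g; first by rewrite expr0 mul1r.
rewrite /= exprSr -mulrA (le_trans _ (ler_wpM2l (exprn_ge0 n c0) (psic g)))//.
rewrite /transition big_distrr /=; apply: ler_sum => l _.
by rewrite mulrCA ler_wpM2l.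
Qed.

End Transition.

(** Invert [1 - y <= expR (- y)] and use [(1 - y) * (1 + y + 2 * y ^+ 2) = 1 + y ^+ 2 * (1 - 2 *
    y)]. *)
Lemma expR_quadratic_ub (R : realType) (y : R) :
  `|y| <= 2^-1 -> expR y <= 1 + y + 2 * y ^+ 2.
Proof.
rewrite ler_norml => /andP[y1 y2].
have y1E : 0 < 1 - y by lra.
have := expR_ge1Dx (- y); rewrite expRN => h.
have {}h : expR y <= (1 - y)^-1.
  by rewrite -[leLHS]invrK lef_pV2 ?posrE ?invr_gt0 ?expR_gt0.
apply: (le_trans h); rewrite -div1r ler_pdivrMr//; nra.
Qed.

(* [2 * s^2 * K^2] is the second-order term of the moment generating function of
   an increment of [psi - n * gamma], which is centred and bounded by [K]. *)
Lemma transition_expR_le (R : realType) (G : groupType) (S : seq G)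
    (m psi : G -> R) (gamma K s : R) :
  (forall l, 0 <= m l) -> \sum_(l <- S) m l = 1 ->
  (forall g, transition S m psi g = psi g + gamma) ->
  (forall g l, l \in S -> `|psi (g * l)%g - psi g - gamma| <= K) ->
  0 <= s -> s * K <= 2^-1 ->
  forall g, transition S m (fun h => expR (s * psi h)) g <=
    expR (s * gamma + 2 * s ^+ 2 * K ^+ 2) * expR (s * psi g).
Proof.
move=> m0 m1 psiE psiK s0 sK g.
pose D l := psi (g * l)%g - psi g - gamma.
have -> : transition S m (fun h => expR (s * psi h)) g =
    expR (s * (psi g + gamma)) * \sum_(l <- S) m l * expR (s * D l).
  rewrite big_distrr; apply: eq_bigr => l _ /=; rewrite mulrCA -expRD.
  by congr (_ * expR _); rewrite /D; ring.
rewrite -expRD (_ : _ + s * psi g = s * (psi g + gamma) + 2 * s ^+ 2 * K ^+ 2).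
  2: by ring.
rewrite [leRHS]expRD ler_pM2l ?expR_gt0//.
apply: le_trans (expR_ge1Dx _).
have -> : 1 + 2 * s ^+ 2 * K ^+ 2 =
    \sum_(l <- S) m l * (1 + s * D l + 2 * s ^+ 2 * K ^+ 2).
  have mD : \sum_(l <- S) m l * D l = 0.
    transitivity (transition S m psi g - (psi g + gamma) * \sum_(l <- S) m l).
      rewrite /transition mulr_sumr -sumrB; apply: eq_bigr => l _.
      by rewrite /D; ring.
    by rewrite psiE m1 mulr1 subrr.
  transitivity ((1 + 2 * s ^+ 2 * K ^+ 2) * (\sum_(l <- S) m l)
     + s * \sum_(l <- S) m l * D l); first by rewrite m1 mD mulr1 mulr0 addr0.
  by rewrite !mulr_sumr -big_split; apply: eq_bigr => l _ /=; ring.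
rewrite big_seq [leRHS]big_seq; apply: ler_sum => l lS.
rewrite ler_wpM2l//.
have DK := psiK g l lS; rewrite -/(D l) in DK.
have sD : `|s * D l| <= 2^-1.
  by rewrite normrM ger0_norm//; apply: le_trans sK; rewrite ler_wpM2l.
rewrite (le_trans (expR_quadratic_ub sD))// lerD2l exprMn -mulrA ler_wpM2l//.
rewrite ler_wpM2l ?sqr_ge0// -(real_normK (num_real (D l))).
by rewrite ler_sqr ?nnegrE ?(le_trans _ DK).
Qed.

(** Almost surely [y] takes its value in [S]; a union bound over [S] does the rest. *)
Lemma measure_letters_le d (T : measurableType d) (R : realType)
    (P : probability T R) (U : eqType) (S : seq U) (E : set T) (y : T -> U) :
  measurable E -> (forall F, measurable (y @^-1` F)) ->
  P (y @^-1` [set l | l \in S]) = 1%E ->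
  (P E <= \sum_(l <- S) P (E `&` y @^-1` [set l]))%E.
Proof.
move=> mE my PS.
have -> : P E = P (E `&` y @^-1` [set l | l \in S]).
  apply/eqP; rewrite eq_le; apply/andP; split; last first.
    by rewrite le_measure ?inE//; exact: measurableI.
  rewrite -[leRHS]adde0 -(_ : P (~` (y @^-1` [set l | l \in S])) = 0%E).
    rewrite (le_trans _ (measureU2 _ _ _))//.
    - rewrite le_measure ?inE//.
        by apply: measurableU; [exact: measurableI|exact: measurableC].
      by move=> w Ew; have [yw|yw] := pselect (y w \in S); [left|right].
    - exact: measurableI.
    - exact: measurableC.
  by rewrite probability_setC// PS subee.
elim: S {PS} => [|k S IH].
  rewrite big_nil (_ : _ `&` _ = set0) ?measure0//.
  by apply/seteqP; split => // w [].
rewrite big_cons (le_trans _ (leeD2l _ IH))//.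
rewrite (le_trans _ (measureU2 _ _ _))//; try exact: measurableI.
rewrite le_measure ?inE//; first exact: measurableI.
  by apply: measurableU; exact: measurableI.
move=> w [Ew /=]; rewrite in_cons => /orP[/eqP yk|yS]; [left|right] => //.
Qed.

(** * Deviation bounds for the random walk *)

Section RandomWalk.
Variables (A B : groupType).
Local Notation G := (freeprod A B).
Variables (R : realType) (d : measure_display) (T : measurableType d).
Variables (P : probability T R) (x : nat -> {RV P >-> G}).
Hypothesis countG : countable [set: G].

Lemma measurable_step n (E : set G) : measurable (x n @^-1` E).
Proof. by rewrite -[_ @^-1` _]setTI; exact: measurable_funPT. Qed.

Lemma measurable_random_walk n (E : set G) :
  measurable (random_walk x n @^-1` E).
Proof.
elim: n E => [|n IH] E.
  have [E1|E1] := pselect (E 1%g).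
    by rewrite (_ : _ @^-1` _ = setT)//; apply/seteqP; split.
  by rewrite (_ : _ @^-1` _ = set0)//; apply/seteqP; split.
rewrite (_ : _ @^-1` _ = \bigcup_g (random_walk x n @^-1` [set g] `&`
    x n @^-1` [set h | E (g * h)%g])); last first.
  apply/seteqP; split => w /=; first by exists (random_walk x n w).
  by case=> g _ [/= <-].
apply: countable_bigcupT_measurable => // g.
by apply: measurableI; [exact: IH|exact: measurable_step].
Qed.

Variables (S : seq G) (m : G -> R).
Hypothesis m_ge0 : forall l, 0 <= m l.
Hypothesis stepS : forall n, P (x n @^-1` [set l | l \in S]) = 1%E.
Hypothesis stepE : forall n l, l \in S -> P (x n @^-1` [set l]) = (m l)%:E.
Hypothesis indep : mutually_independent x.

(* The events [x i \in E i], [n <= i], carried along are what makes the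
   independence of the past and of the future usable in the induction. *)
Lemma random_walk_joint_le n (psi : G -> R) (F : set G) (J : {fset nat})
    (E : nat -> set G) :
  (forall g, 0 <= psi g) -> (forall g, F g -> 1 <= psi g) ->
  (forall i, i \in J -> (n <= i)%N) ->
  (P (random_walk x n @^-1` F `&` \bigcap_(i in [set` J]) (x i @^-1` E i)) <=
   (iter n (transition S m) psi 1%g)%:E * \prod_(i <- J) P (x i @^-1` E i))%E.
Proof.
have mJ (K : {fset nat}) E' :
    measurable (\bigcap_(i in [set` K]) (x i @^-1` E' i)).
  by apply: fin_bigcap_measurable => // i _; exact: measurable_step.
have P0 (K : {fset nat}) E' : (0 <= \prod_(i <- K) P (x i @^-1` E' i))%E.
  by elim/big_rec: _ => // i z _; exact: mule_ge0.
elim: n psi F J E => [|n IH] psi F J E psi0 psiF nJ.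
  have [F1|F1] := pselect (F 1%g); last first.
    rewrite (_ : _ `&` _ = set0) ?measure0 ?mule_ge0 ?lee_fin//.
    by apply/seteqP; split => // w [].
  rewrite (_ : _ `&` _ = \bigcap_(i in [set` J]) (x i @^-1` E i)).
    by rewrite indep// -[leLHS]mul1e lee_wpmul2r// lee_fin psiF.
  by apply/seteqP; split => w // -[].
rewrite iterSr iter_transition_sum -sumEFin.
rewrite ge0_sume_distrl//; last first.
  by move=> l _; rewrite lee_fin mulr_ge0// iter_transition_ge0.
rewrite (le_trans (measure_letters_le (S := S) _ (@measurable_step n) (stepS n)))//.
  by apply: measurableI => //; exact: measurable_random_walk.
rewrite big_seq [leRHS]big_seq; apply: lee_sum => l lS.
(* The event that step [n] is [l] joins the future events, at an index outside [J]; the past then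
   stops at time [n]. *)
pose E' i := if i == n then [set l] else E i.
have nJn : n \notin J by apply/negP => /nJ; rewrite ltnn.
have E'E i : i \in J -> E' i = E i.
  by rewrite /E'; case: eqP => // ->; rewrite (negbTE nJn).
have := IH (fun g => psi (g * l)%g) [set g | F (g * l)%g] (n |` J)%fset E'.
have E'n : E' n = [set l] by rewrite /E' eqxx.
rewrite big_fsetU1//= E'n stepE//.
rewrite (eq_big_seq (fun i => P (x i @^-1` E i))); last by move=> i /E'E ->.
rewrite muleA -EFinM [_ * m l]mulrC => IHl; apply: le_trans (IHl _ _ _) => //.
- have mRW := @measurable_random_walk n.
  have mL := measurableI _ _ (measurableI _ _ (measurable_random_walk n.+1 F)
    (mJ J E)) (@measurable_step n [set l]).
  have mR := measurableI _ _ (mRW [set g | F (g * l)%g]) (mJ (n |` J)%fset E').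
  apply: le_measure; rewrite ?inE//.
  move=> w [[/= Fw Ew] xw]; split => /=; first by rewrite -xw.
  move=> i /=; rewrite in_fset1U => /orP[/eqP ->|iJ].
    by rewrite E'n.
  by rewrite E'E//; exact: Ew.
- by move=> g; exact: psiF.
- by move=> i; rewrite in_fset1U => /orP[/eqP ->//|/nJ/ltnW].
Qed.

(** Markov's inequality, the iterate playing the role of the expectation. *)
Lemma random_walk_le n (psi : G -> R) (F : set G) :
  (forall g, 0 <= psi g) -> (forall g, F g -> 1 <= psi g) ->
  (P (random_walk x n @^-1` F) <= (iter n (transition S m) psi 1%g)%:E)%E.
Proof.
move=> psi0 psiF.
have := @random_walk_joint_le n psi F fset0 (fun=> setT) psi0 psiF.
rewrite big_seq_fset0 mule1 set_fset0 bigcap_set0 setIT; exact.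
Qed.

Variables (psi : G -> R) (gamma K : R).
Hypothesis m1 : \sum_(l <- S) m l = 1.
Hypothesis psiE : forall g, transition S m psi g = psi g + gamma.
Hypothesis psiK : forall g l, l \in S -> `|psi (g * l)%g - psi g - gamma| <= K.

Lemma random_walk_upper_deviation (e : R) : 0 < e ->
  exists c z : R, [/\ 0 < c, 0 < z, z < 1 & forall n,
  (P (random_walk x n @^-1` [set g | (n%:R * (gamma + e) <= psi g)%R]) <=
   (c * z ^+ n)%:E)%E].
Proof.
move=> e0.
pose K1 := `|K| + 1.
have K1_gt0 : 0 < K1 by rewrite ltr_wpDl.
(* The first bound makes [transition_expR_le] applicable; the second keeps the second-order term
   below half of the gain [s * e]. *)
pose s := Num.min (2 * K1)^-1 (e / (4 * K1 ^+ 2)).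
have s0 : 0 < s.
  by rewrite /s lt_min invr_gt0 divr_gt0// mulr_gt0// exprn_gt0.
have sK : s * K1 <= 2^-1.
  have : s * K1 <= (2 * K1)^-1 * K1.
    by apply: ler_wpM2r; [exact: ltW|rewrite ge_min lexx].
  by rewrite invfM mulfVK// gt_eqF.
have sKe : 2 * s ^+ 2 * K1 ^+ 2 <= s * e / 2.
  have : s * (4 * K1 ^+ 2) <= e.
    by rewrite -ler_pdivlMr ?mulr_gt0 ?exprn_gt0// /s ge_min lexx orbT.
  by rewrite -(ler_pM2l s0); lra.
exists (expR (s * psi 1%g)), (expR (- (s * e / 2))); split.
- exact: expR_gt0.
- exact: expR_gt0.
- by rewrite expR_lt1 oppr_lt0 divr_gt0// mulr_gt0.
move=> n.
(* Subtracting a constant preserves the increments and turns the event into [0 <= phi]. *)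
pose phi g := psi g - n%:R * (gamma + e).
have phiE g : transition S m phi g = phi g + gamma.
  transitivity (transition S m psi g
      - n%:R * (gamma + e) * \sum_(l <- S) m l).
    rewrite /transition mulr_sumr -sumrB; apply: eq_bigr => l _.
    by rewrite /phi; ring.
  by rewrite psiE m1 /phi; ring.
have phiK g l : l \in S -> `|phi (g * l)%g - phi g - gamma| <= K1.
  move=> lS; rewrite (_ : _ - gamma = psi (g * l)%g - psi g - gamma).
    apply: (le_trans (psiK g lS)); apply: (le_trans (ler_norm _)).
    by rewrite lerDl.
  by rewrite /phi; ring.
have := transition_expR_le m_ge0 m1 phiE phiK (ltW s0) sK.
move=> /(iter_transition_le m_ge0 n 1%g (expR_ge0 _)) le_n.
apply: (le_trans (@random_walk_le n (fun g => expR (s * phi g)) _ _ _)).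
- by move=> g; exact: expR_ge0.
- move=> g /= ng; rewrite -expR0 ler_expR mulr_ge0 ?(ltW s0)//.
  by rewrite /phi subr_ge0.
rewrite lee_fin; apply: (le_trans le_n).
rewrite -!expRM_natl -!expRD ler_expR /phi.
have := ler_wpM2l (ler0n R n) sKe; lra.
Qed.

(** Borel-Cantelli: a convergent geometric series dominates the deviation probabilities. *)
Lemma random_walk_eventually_lt (e : R) : 0 < e ->
  {ae P, forall w, \forall n \near \oo,
    psi (random_walk x n w) < n%:R * (gamma + e)}.
Proof.
move=> /random_walk_upper_deviation[c [z [c0 z0 z1 Pcz]]].
pose F n := random_walk x n @^-1` [set g | n%:R * (gamma + e) <= psi g].
have mF n : measurable (F n) by exact: measurable_random_walk.
exists (lim_sup_set F); split.
- by apply: bigcap_measurable => // k _; exact: bigcup_measurable.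
- apply: lim_sup_set_cvg0 => //.
  apply: (@le_lt_trans _ _ (c / (1 - z))%:E); last exact: ltry.
  apply: lime_le; first exact: is_cvg_nneseries.
  apply: nearW => n; rewrite (@le_trans _ _ (\sum_(0 <= i < n) (c * z ^+ i)%:E)%E)//.
    by apply: lee_sum => i _; exact: Pcz.
  rewrite sumEFin lee_fin; apply: geometric_le_lim => //; first exact: ltW.
  by rewrite ger0_norm// ltW.
move=> w /= nw n _; apply: contrapT => Fw; apply: nw; exists n => // k /= nk.
by rewrite ltNge; apply/negP => Fk; apply: Fw; exists k.
Qed.

End RandomWalk.

Lemma random_walk_cvg (A B : groupType) (R : realType) (d : measure_display)
    (T : measurableType d) (P : probability T R)
    (x : nat -> {RV P >-> freeprod A B}) (S : seq (freeprod A B))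
    (m psi len : freeprod A B -> R) (gamma K C : R) :
  countable [set: freeprod A B] ->
  (forall l, 0 <= m l) -> \sum_(l <- S) m l = 1 ->
  (forall n, P (x n @^-1` [set l | l \in S]) = 1%E) ->
  (forall n l, l \in S -> P (x n @^-1` [set l]) = (m l)%:E) ->
  mutually_independent x ->
  (forall g, transition S m psi g = psi g + gamma) ->
  (forall g l, l \in S -> `|len (g * l)%g - len g| <= K) ->
  (forall g, `|psi g - len g| <= C) ->
  {ae P, forall w, len (random_walk x n w) / n%:R @[n --> \oo] --> gamma}.
Proof.
move=> countG m0 m1 stepS stepE indep psiE lenK psiC.
have psiK g l : l \in S ->
    `|psi (g * l)%g - psi g - gamma| <= 2 * C + K + `|gamma|.
  move=> lS; have := lenK g l lS; have := psiC g; have := psiC (g * l)%g.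
  have := ler_norm gamma; have := ler_norm (- gamma); rewrite normrN.
  move: `|gamma| => c gc1 gc2; rewrite !ler_norml.
  by move=> /andP[? ?] /andP[? ?] /andP[? ?]; apply/andP; split; lra.
(* Lower deviations of [psi] are upper deviations of [- psi]. *)
have NpsiE g : transition S m (fun h => - psi h) g = - psi g + - gamma.
  rewrite -opprD -psiE /transition -sumrN.
  by apply: eq_bigr => l _; rewrite mulrN.
have NpsiK g l : l \in S -> 
    `|- psi (g * l)%g - - psi g - - gamma| <= 2 * C + K + `|gamma|.
  move=> lS; rewrite (_ : _ - - gamma = - (psi (g * l)%g - psi g - gamma)).
    by rewrite normrN psiK.
  by ring.
(* Margins of the form [k.+1%:R^-1] leave only countably many almost sure events to intersect. *)
have inv0 k : 0 < (k.+1%:R : R)^-1 by rewrite invr_gt0.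
have up := ae_foralln (fun k => random_walk_eventually_lt countG m0 stepS stepE
  indep m1 psiE psiK (inv0 k)).
have dn := ae_foralln (fun k => random_walk_eventually_lt countG m0 stepS stepE
  indep m1 NpsiE NpsiK (inv0 k)).
apply: filterS2 up dn => w up dn.
apply/cvgrPdist_le => e e0.
(* Half of [e] absorbs the margin, the other half the distance [C] divided by [n]. *)
pose k := Num.truncn (2 / e).
have ke : k.+1%:R^-1 <= e / 2.
  rewrite -[leRHS]invrK lef_pV2 ?posrE ?invr_gt0 ?divr_gt0//.
  by rewrite invf_div ltW// truncnS_gt.
near=> n.
have n0 : 0 < n%:R :> R by rewrite ltr0n; near: n; exact: nbhs_infty_gt.
have nC : C <= n%:R * (e / 2).
  rewrite -ler_pdivrMr ?divr_gt0//; near: n; exact: nbhs_infty_ger.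
have un : psi (random_walk x n w) < n%:R * (gamma + k.+1%:R^-1).
  by near: n; exact: up.
have ln : - psi (random_walk x n w) < n%:R * (- gamma + k.+1%:R^-1).
  by near: n; exact: dn.
have nk : n%:R * k.+1%:R^-1 <= n%:R * (e / 2) by rewrite ler_pM2l.
have := psiC (random_walk x n w); rewrite ler_norml => /andP[lC uC].
have n1 : n%:R != 0 :> R by rewrite gt_eqF.
rewrite -[gamma](mulfK n1) -mulrBl normrM normfV (gtr0_norm n0) ler_pdivrMr//.
rewrite ler_norml; move: un ln nk nC lC uC.
move: (k.+1%:R^-1) (n%:R : R) (psi _) (len _) => kappa N y L *; apply/andP.
by split; lra.
Unshelve. all: by end_near.
Qed.

(** * Word length in a free product *)

Lemma countable_freeprod (A B : groupType) (f : A + B -> nat) :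
  injective f -> countable [set: freeprod A B].
Proof.
move=> fI; apply/countable_injP.
exists (fun g => choice.pickle (map f (normal_form g))) => g h _ _.
move=> /(pcan_inj choice.pickleK)/(inj_map fI) gh; exact: val_inj.
Qed.

Section FreeProductLength.
Local Open Scope group_scope.
Variables A B : groupType.
Local Notation G := (freeprod A B).
Implicit Types (l : A + B) (g h : G).

Definition letter l : G := FreeProd (reduced_letter l).

Lemma normal_form_letterM l g :
  normal_form (letter l * g) = lmul l (normal_form g).
Proof. by rewrite [LHS]wmul_push; last exact: normal_formP. Qed.

Lemma letterV l : (letter l)^-1 = letter (linv l).
Proof.
apply: (@mulgI _ (letter l)); rewrite mulgV; apply: val_inj.
rewrite [RHS]normal_form_letterM /= /push.
by case: l => y /=; rewrite eq_invg1; case: eqP => [->|_] /=;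
  rewrite /push /= ?eqxx// mulgV eqxx.
Qed.

Lemma size_lmul l (w : seq (A + B)) :
  (size (lmul l w) <= (size w).+1)%N /\ (size w <= (size (lmul l w)).+1)%N.
Proof.
by case: l w => [y|y] [|[z|z] w] /=; rewrite /push; case: ifP => _ /=; split; lia.
Qed.

Lemma size_winv (w : seq (A + B)) : size (winv w) = size w.
Proof. by rewrite size_rev size_map. Qed.

(** Since [lmul] acts on the head of a word, right multiplication is read on the inverses, which
    have the same size. *)
Lemma size_normal_form_Mletter (R : realType) g l :
  (`|(size (normal_form (g * letter l)%g))%:R - (size (normal_form g))%:R|
    <= 1 :> R)%R.
Proof.
rewrite -(size_winv (normal_form g)) -(size_winv (normal_form (g * _))).
rewrite -[winv _]/(normal_form (g * letter l)^-1).
rewrite -[winv (normal_form g)]/(normal_form g^-1).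
rewrite invMg letterV normal_form_letterM.
have [] := size_lmul (linv l) (normal_form g^-1).
rewrite -!(ler_nat R) -!natr1 => h1 h2.
by rewrite ler_norml; apply/andP; split; lra.
Qed.

Lemma prod_letters g : \prod_(h <- map letter (normal_form g)) h = g.
Proof.
case: g => w; elim: w => [|l w IH] rw /=; first by rewrite big_nil; exact: val_inj.
have /= IHw := IH (reduced_behead rw).
rewrite big_cons IHw; apply: val_inj; rewrite [LHS]normal_form_letterM /=.
by have := wmulw0 rw; rewrite /= wmulw0// (reduced_behead rw).
Qed.

(** The normal form is itself a product of letters; conversely, a letter lengthens a normal form by
    at most one. *)
Lemma word_length_letters (S : set G) g :
  (forall h, S h <-> exists2 l, nontrivial_letter l & h = letter l) ->
  word_length S g = size (normal_form g).
Proof.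
move=> SE.
have gS : is_product_of S g (size (normal_form g)).
  exists (map letter (normal_form g)); split.
  - by rewrite size_map.
  - move=> _ /mapP[l lg ->]; apply/SE; exists l => //.
    by have /andP[/allP/(_ l lg)] := normal_formP g.
  - by rewrite prod_letters.
rewrite /word_length; case: pselect => [ex|]; last first.
  by case; exists (size (normal_form g)); apply/asboolP.
case: ex_minnP => n /asboolP[s [<- sS gE]] n_min.
apply/eqP; rewrite eqn_leq n_min /=; last exact/asboolP.
rewrite {}gE {n_min gS}; elim: s sS => [|h s IH] sS; first by rewrite big_nil.
rewrite big_cons; have [l _ ->] := (SE h).1 (sS h (mem_head _ _)).
rewrite normal_form_letterM (leq_trans (size_lmul _ _).1)// ltnS IH// => k ks.
by apply: sS; rewrite in_cons ks orbT.
Qed.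

End FreeProductLength.

(** * Generators of the cyclic groups of orders 2 and 3 *)

Lemma generator_setT_Z2 (a0 : 'Z_2) : generator [set: 'Z_2]%G a0 ->
  a0 != 1%g /\ forall y : 'Z_2, y != 1%g -> y = a0.
Proof.
move=> /eqP gen; have oa : #[a0]%g = 2%N by rewrite orderE -gen cardsT card_ord.
have a1 : a0 != 1%g by apply/eqP => a1; rewrite a1 order1 in oa.
split=> // y y1.
by move: a0 y {oa gen} a1 y1 => [[|[|?]] ?] [[|[|?]] ?] //= _ _; exact: val_inj.
Qed.

Lemma generator_setT_Z3 (b0 : 'Z_3) : generator [set: 'Z_3]%G b0 ->
  [/\ b0 != 1%g, (b0 * b0 * b0)%g = 1%g &
    forall y : 'Z_3, y != 1%g -> y = b0 \/ y = (b0 * b0)%g].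
Proof.
move=> /eqP gen; have ob : #[b0]%g = 3%N by rewrite orderE -gen cardsT card_ord.
have b1 : b0 != 1%g by apply/eqP => b1; rewrite b1 order1 in ob.
split=> //.
  by move: b0 {ob gen} b1 => [[|[|[|?]]] ?] //= _; exact: val_inj.
move=> y y1.
move: b0 y {ob gen} b1 y1 => [[|[|[|?]]] ?] [[|[|[|?]]] ?] //= _ _;
  (by left; exact: val_inj) || (by right; exact: val_inj).
Qed.

(** * The mean Busemann function *)

Section Busemann.
Variables (A B : groupType) (R : realType) (nu : B -> R).

(* Mean value of the Busemann cocycle [lim_k |g xi_k| - |xi_k|], as a function of
   the normal form of [g^-1], over the infinite reduced words [xi] that start in
   [A] (if [startA]) or in [B], and whose letters in [B] are independent of law
   [nu]: the first letter of [g^-1] cancels that of [xi] exactly if they agree.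
   The group [A] is thought of as having order 2: its letters always cancel. *)
Fixpoint busemann (startA : bool) (w : seq (A + B)) : R :=
  match w with
  | [::] => 0
  | inl _ :: v =>
      if startA then busemann false v - 1 else (size v)%:R + 1
  | inr y :: v =>
      if startA then (size v)%:R + 1
      else nu y * (busemann true v - 1) + (1 - nu y) * (size v)%:R
  end.

(** First letters from different factors neither cancel nor merge. *)
Lemma busemann_size (w : seq (A + B)) (startA : bool) :
  (if w is l :: _ then alternate (if startA then inl 1%g else inr 1%g) l
   else true) ->
  busemann startA w = (size w)%:R.
Proof. by case: w startA => [|[y|y] w] [] //= _; rewrite -natr1. Qed.

Definition busemann_mean (alpha : R) (w : seq (A + B)) : R :=
  alpha * busemann true w + (1 - alpha) * busemann false w.

(** Each letter in [B] stops the cancellation with probability at least [1 - M], so the mean loss of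
    length stays bounded. *)
Lemma busemann_mean_bounded (M alpha : R) : M < 1 ->
  (forall y, 0 <= nu y <= M) -> 0 <= alpha <= 1 ->
  exists C, forall w, `|busemann_mean alpha w - (size w)%:R| <= C.
Proof.
move=> M1 nuM /andP[al0 al1].
(* The loss is at most [c] for infinite words starting in [B], and [c + 2] for those starting in
   [A], where one more letter may cancel first; the recursion closes when [c = M * (c + 3) + 1]. *)
pose c := (1 + 3 * M) / (1 - M).
have M0 : 0 <= M by have /andP[] := nuM 1%g; exact: le_trans.
have c0 : 0 <= c by rewrite divr_ge0; lra.
have cE : M * (c + 3) + 1 = c.
  by rewrite /c; field; rewrite subr_eq0 gt_eqF.
suff H w : (size w)%:R - (c + 2) <= busemann true w <= (size w)%:R /\
    (size w)%:R - c <= busemann false w <= (size w)%:R.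
  exists (c + 2) => w; rewrite ler_norml /busemann_mean.
  by have [/andP[? ?] /andP[? ?]] := H w; apply/andP; split; nra.
elim: w => [|[y|y] w [/andP[IH1 IH2] /andP[IH3 IH4]]] /=.
- by split; lra.
- by rewrite -natr1; split; lra.
rewrite -natr1; have /andP[nu0 nu1] := nuM y; split; first by lra.
by apply/andP; split; nra.
Qed.

End Busemann.

Section Corrector.
Variables (R : realType) (a0 : 'Z_2) (b0 : 'Z_3).
Hypothesis a0_gen : generator [set: 'Z_2]%G a0.
Hypothesis b0_gen : generator [set: 'Z_3]%G b0.
Variables (p q rho alpha : R).
Let r := 1 - p - q.
Let nu (y : 'Z_3) : R := if y == b0 then rho else 1 - rho.
Local Notation mean := (busemann_mean nu alpha).

(** These two hypotheses say that left multiplication by a random letter preserves the masses of the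
    infinite words starting with [a0] and with [b0 * b0]. *)
Hypothesis stationaryA :
  alpha = (1 - alpha) * (1 - p * rho - q * (1 - rho)).
Hypothesis stationaryB :
  r * alpha * (1 - rho) + p * (1 - alpha) * rho + q * alpha =
  (1 - alpha) * (1 - rho).

(** Here [w] is the normal form of [g^-1], which a step [l] multiplies on the left by [l^-1]: hence
    [p] goes with [b0 * b0] and [q] with [b0]. The constant is the value of the left side at the
    empty word, rewritten with stationarity. *)
Lemma busemann_mean_harmonic w : reduced w ->
  r * mean (lmul (inl a0) w) + p * mean (lmul (inr (b0 * b0)%g) w) +
    q * mean (lmul (inr b0) w) =
  mean w + (p * (2 * alpha + (1 - alpha) * (3 * rho - 2)) +
    q * (2 * alpha + (1 - alpha) * (1 - 3 * rho)) + 2 * alpha - 1).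
Proof.
have [a1 aE] := generator_setT_Z2 a0_gen.
have [b1 bbb bE] := generator_setT_Z3 b0_gen.
have aa : (a0 * a0)%g = 1%g.
  apply/eqP; apply: contraNT a1 => /aE aa0.
  by apply/eqP/(mulgI a0); rewrite mulg1 aa0.
have bb1 : (b0 * b0)%g != 1%g.
  by apply: contraNneq b1 => bb; rewrite -bbb bb mul1g.
have b_bb : (b0 * (b0 * b0))%g = 1%g by rewrite mulgA.
have bb_bb : (b0 * b0 * (b0 * b0))%g = b0 by rewrite mulgA bbb mul1g.
have bbNb : ((b0 * b0)%g == b0) = false.
  by apply: contraNF b1 => /eqP bb; apply/eqP/(mulgI b0); rewrite mulg1.
have nub : nu b0 = rho by rewrite /nu eqxx.
have nubb : nu (b0 * b0)%g = 1 - rho by rewrite /nu bbNb.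
rewrite /busemann_mean; case: w => [_|[y|y] v].
- rewrite /= /push /= a1 b1 bb1 /= nub nubb /r.
  by move: stationaryA stationaryB; rewrite /r; lra.
- rewrite reduced_cons => /and3P[/= /aE -> _ av].
  rewrite /push /= aa eqxx b1 bb1 /= nub nubb -?natr1.
  rewrite (@busemann_size _ _ _ nu v true av).
  (* The coefficient of the loss of the tail [v] vanishes by stationarity; this product is not
     linear, so [lra] must be given it. *)
  have := congr1 (fun z => z * (busemann nu false v - (size v)%:R)) stationaryA.
  by move: stationaryA stationaryB; rewrite /r; lra.
- rewrite reduced_cons => /and3P[/= /bE[] -> _ av].
  + rewrite /push /= bbb eqxx a1 bb1 /= nub nubb -?natr1.
    rewrite (@busemann_size _ _ _ nu v false av).
    have := congr1 (fun z => z * (busemann nu true v - (size v)%:R)) stationaryB.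
    have := congr1 (fun z => z * (busemann nu true v - (size v)%:R)) stationaryA.
    by move: stationaryA stationaryB; rewrite /r; lra.
  + rewrite /push /= b_bb bb_bb eqxx a1 b1 /= nub nubb -?natr1.
    rewrite (@busemann_size _ _ _ nu v false av).
    have := congr1 (fun z => z * (busemann nu true v - (size v)%:R)) stationaryB.
    have := congr1 (fun z => z * (busemann nu true v - (size v)%:R)) stationaryA.
    by move: stationaryA stationaryB; rewrite /r; lra.
Qed.

End Corrector.

(** * The drift on the free product of the groups of orders 2 and 3 *)

Theorem mainTheorem3 (R : realType) (a0 : 'Z_2) (b0 : 'Z_3)
  (a0_gen : generator [set: 'Z_2]%G a0) (b0_gen : generator [set: 'Z_3]%G b0)
  (p q : R) (p_ge0 : 0 <= p) (q_ge0 : 0 <= q)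
  (pq_gt0 : 0 < p + q) (pq_lt1 : p + q < 1)
  (mu : probability (freeprod 'Z_2 'Z_3) R)
  (d : measure_display) (T : measurableType d) (P : probability T R)
  (x : nat -> {RV P >-> freeprod 'Z_2 'Z_3}) :
  let a := fpl _ a0 in
  let b := fpr _ b0 in
  let r := 1 - p - q in
  mu [set a] = r%:E ->
  mu [set b] = p%:E ->
  mu [set (b ^+ 2)%g] = q%:E ->
  iid_of_law x mu ->
  is_drift P [set a; b; (b ^+ 2)%g] (random_walk x)
    (2 * r * (p * q - p - q +
       Num.sqrt ((p ^+ 2 + q ^+ 2) * (3 + (r + p) ^+ 2 + (r + q) ^+ 2)
                 + 2 * p * q * (2 * r + 1)))
     / ((r + p) ^+ 2 + (r + q) ^+ 2 - p * q + 2)).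
Proof.
move=> a b r mua mub mub2 [indep law].
have [a1 aE] := generator_setT_Z2 a0_gen.
have [b1 bbb bE] := generator_setT_Z3 b0_gen.
have bb1 : (b0 * b0)%g != 1%g.
  by apply: contraNneq b1 => bb; rewrite -bbb bb mul1g.
have b2E : (b ^+ 2)%g = fpr _ (b0 * b0)%g by rewrite fprM.
have neq_b_b2 : b != (b ^+ 2)%g.
  apply/eqP => bb; case/negP: (b1); apply/eqP/(mulgI b0).
  have := congr1 (@normal_form _ _) bb.
  by rewrite b2E /= /push /= b1 bb1 mulg1 => -[<-].
have neq_a_b : a != b.
  by apply/eqP => /(congr1 (@normal_form _ _)); rewrite /= /push /= a1 b1.
have neq_a_b2 : a != (b ^+ 2)%g.
  by apply/eqP => /(congr1 (@normal_form _ _)); rewrite b2E /= /push /= a1 bb1.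
have S_letters h : [set a; b; (b ^+ 2)%g] h <->
    exists2 l, nontrivial_letter l & h = letter l.
  split=> [[[->|->]|->]|[[y|y] /= y1 ->]].
  - by exists (inl a0).
  - by exists (inr b0).
  - by exists (inr (b0 * b0)%g).
  - by left; left; rewrite (aE y y1).
  - by have [->|->] := bE y y1; [left; right|right; rewrite b2E].
have [rho [rho0 rho1 rhoE]] :=
  stationary_root_exists p_ge0 q_ge0 pq_gt0 pq_lt1.
rewrite -(stationary_drift p_ge0 q_ge0 pq_gt0 pq_lt1 rho0 rho1 rhoE) -/r.
pose t := 1 - p * rho - q * (1 - rho); rewrite -/t.
have t0 : 0 < 1 + t by rewrite /t; nra.
(* The solution of [alpha = (1 - alpha) * t], the stationarity of the first letter. *)
pose alpha := t / (1 + t).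
have alphaE : 1 - alpha = (1 + t)^-1.
  by rewrite /alpha; field; rewrite gt_eqF.
pose nu (y : 'Z_3) := if y == b0 then rho else 1 - rho.
pose psi (g : freeprod 'Z_2 'Z_3) : R :=
  busemann_mean nu alpha (normal_form g^-1%g).
pose len (g : freeprod 'Z_2 'Z_3) : R := (size (normal_form g))%:R.
pose m l := if l == a then r else if l == b then p else
  if l == (b ^+ 2)%g then q else 0.
pose S := [:: a; b; (b ^+ 2)%g].
have r0 : 0 <= r by rewrite /r; lra.
have m0 l : 0 <= m l by rewrite /m; do ?case: ifP.
have ma : m a = r by rewrite /m eqxx.
have mb : m b = p by rewrite /m eq_sym (negbTE neq_a_b) eqxx.
have mb2 : m (b ^+ 2)%g = q.
  by rewrite /m eq_sym (negbTE neq_a_b2) eq_sym (negbTE neq_b_b2) eqxx.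
have m1 : \sum_(l <- S) m l = 1.
  by rewrite /S !big_cons big_nil ma mb mb2 /r; ring.
(* The letters are distinct and their masses add up to [1], so [mu] is carried by [S]. *)
have muS : mu [set l | l \in S] = 1%E.
  rewrite (_ : [set` S] = [set a] `|` ([set b] `|` [set (b ^+ 2)%g])).
    rewrite !measureU//.
    - transitivity (r%:E + (p%:E + q%:E))%E; last first.
        by rewrite -!EFinD /r; congr EFin; ring.
      by congr (_ + (_ + _))%E; [exact: mua|exact: mub|exact: mub2].
    - by apply/seteqP; split => // l [/= -> /eqP]; rewrite (negbTE neq_b_b2).
    - apply/seteqP; split => // l [/= -> [/eqP|/eqP]].
        by rewrite (negbTE neq_a_b).
      by rewrite (negbTE neq_a_b2).
  apply/seteqP; split => l /=; rewrite !inE.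
    by move=> /or3P[]/eqP ->; [left|right; left|right; right].
  by move=> [->|[->|->]]; rewrite eqxx ?orbT.
have stepS n : P (x n @^-1` [set l | l \in S]) = 1%E.
  by rewrite -muS -(law n).
have stepE n l : l \in S -> P (x n @^-1` [set l]) = (m l)%:E.
  move=> lS; transitivity (mu [set l]); first by rewrite -(law n).
  by move: lS; rewrite !inE => /or3P[]/eqP ->; rewrite ?ma ?mb ?mb2.
have lenE g : word_length [set a; b; (b ^+ 2)%g] g = size (normal_form g).
  exact: word_length_letters.
have lenV g : (size (normal_form g^-1%g))%:R = len g by rewrite size_winv.
(* As [rho] lies strictly between [0] and [1], this maximum serves as the [M < 1] of the boundedness
   lemma. *)
have nu01 y : 0 <= nu y <= Num.max rho (1 - rho).
  by rewrite /nu le_max; case: ifP => _; rewrite lexx ?orbT andbT ?subr_ge0 ltW.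
have max1 : Num.max rho (1 - rho) < 1 by rewrite gt_max rho1 ltrBlDr ltrDl.
have alpha01 : 0 <= alpha <= 1.
  rewrite -[X in _ && X]subr_ge0 alphaE invr_ge0 (ltW t0) andbT.
  by rewrite divr_ge0 ?(ltW t0)// /t; nra.
have [C busC] := @busemann_mean_bounded 'Z_2 'Z_3 _ _ _ _ max1 nu01 alpha01.
have psiC g : `|psi g - len g| <= C by rewrite -lenV; exact: busC.
have psi_letter l g : psi (g * letter l)%g =
    busemann_mean nu alpha (lmul (linv l) (normal_form g^-1%g)).
  by rewrite /psi invMg letterV normal_form_letterM.
set gamma := (X in is_drift _ _ _ X).
have gammaE : gamma = p * (2 * alpha + (1 - alpha) * (3 * rho - 2)) +
    q * (2 * alpha + (1 - alpha) * (1 - 3 * rho)) + 2 * alpha - 1.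
  by rewrite /gamma alphaE /alpha; field; rewrite gt_eqF.
have stationaryA : alpha = (1 - alpha) * (1 - p * rho - q * (1 - rho)).
  by rewrite alphaE /alpha mulrC.
(* Multiplied by [1 + t], this is the equation [rhoE]. *)
have stationaryB : r * alpha * (1 - rho) + p * (1 - alpha) * rho + q * alpha =
    (1 - alpha) * (1 - rho).
  by rewrite -[in RHS]rhoE -/t alphaE /alpha /r; field; rewrite gt_eqF.
have aV : a0^-1%g = a0 by apply: aE; rewrite eq_invg1.
have bV : b0^-1%g = (b0 * b0)%g by apply: (@mulgI _ b0); rewrite mulgV mulgA.
have psiE g : transition S m psi g = psi g + gamma.
  rewrite /transition /S !big_cons big_nil ma mb mb2 b2E addr0 addrA.
  rewrite -[a]/(letter (inl a0)) -[b]/(letter (inr b0)).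
  rewrite -[fpr _ _]/(letter (inr (b0 * b0)%g)) !psi_letter.
  have -> : linv (inl a0) = inl a0 :> 'Z_2 + 'Z_3 by rewrite /linv aV.
  have -> : linv (inr b0) = inr (b0 * b0)%g :> 'Z_2 + 'Z_3 by rewrite /linv bV.
  have -> : linv (inr (b0 * b0)%g) = inr b0 :> 'Z_2 + 'Z_3.
    by rewrite /linv -bV invgK.
  rewrite gammaE.
  exact (busemann_mean_harmonic a0_gen b0_gen stationaryA stationaryB
    (normal_formP g^-1%g)).
have lenK g l : l \in S -> `|len (g * l)%g - len g| <= 1.
  move=> lS; have [k _ ->] : exists2 k, nontrivial_letter k & l = letter k.
    by apply/S_letters; move: lS; rewrite !inE => /or3P[]/eqP ->;
      [left; left|left; right|right].
  exact: size_normal_form_Mletter.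
have countG : countable [set: freeprod 'Z_2 'Z_3].
  exact: (countable_freeprod (pcan_inj choice.pickleK)).
have := random_walk_cvg countG m0 m1 stepS stepE indep psiE lenK psiC.
by apply: filterS => w; rewrite /len; under eq_cvg do rewrite -lenE.
Qed.
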